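(* Let $q$ be a complex number with $|q|<1$. Then $$ \sum_{n=0}^{\infty}\frac{q^{2n^2}(q;q^2)_n^2 (q;q^2)_{2n}}{(q^2;q^2)_{2n}(q^6;q^6)_n^2 }[8n+1] =\frac{(q^3;q^2)_\infty (q^3;q^6)_\infty }{(q^2;q^2)_\infty (q^6;q^6)_\infty}. $$
   Context: For $|q|<1$ and a complex number $a$, $(a;q)_\infty=\prod_{j=0}^\infty(1-aq^j)$ and, for a nonnegative integer $n$, $(a;q)_n=\prod_{j=0}^{n-1}(1-aq^j)$ (with $(a;q)_0=1$); these are used with base $q^2$ or $q^6$ as indicated, e.g. $(a;q^6)_n=\prod_{j=0}^{n-1}(1-aq^{6j})$. The $q$-number is $[m]=(1-q^m)/(1-q)$. *)

(* Defs.v *)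
From HB Require Import structures.
From mathcomp Require Import all_boot all_order all_algebra.
From mathcomp Require Import all_classical all_reals all_analysis.
From mathcomp Require Import complex.

Set Implicit Arguments.
Unset Strict Implicit.
Unset Printing Implicit Defensive.

Import Order.TTheory GRing.Theory Num.Theory.
Import numFieldNormedType.Exports.

Local Open Scope classical_set_scope.
Local Open Scope ring_scope.

Section QSeries.
Variable K : numFieldType.
Implicit Types (a p q : K) (n m : nat).

Definition qpoch a p n : K := \prod_(j < n) (1 - a * p ^+ j).

(* [lim] is an unspecified default value when the partial products diverge;
   for [`|p| < 1] in the complex numbers they always converge. *)
Definition qpoch_inf a p : K := lim (qpoch a p n @[n --> \oo]).

Definition qnum q m : K := (1 - q ^+ m) / (1 - q).

End QSeries.

(* Main.v *)
Require Import Defs.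
From HB Require Import structures.
From mathcomp Require Import all_boot all_order all_algebra ring zify.
From mathcomp Require Import all_classical all_reals all_analysis.
From mathcomp Require Import complex.
Import Order.TTheory GRing.Theory Num.Theory.
Import numFieldNormedType.Exports.
Local Open Scope classical_set_scope.
Local Open Scope ring_scope.

Set Implicit Arguments.
Unset Strict Implicit.

(* Wilf-Zeilberger argument.  The summand u_k is deformed to
     F(N,k) = u_k * prod_(j<k) (1 - q^(6N-6j)) (1 - q^(6N+6j+3))
                             / ((1 - q^(6N-2j)) (1 - q^(6N+2j+3))),
   which vanishes for k > N (a terminating instance of the cubic summations of
   Gasper and Rahman).  A rational certificate shows that
   sum_k F(N+1,k) = pi_N * sum_k F(N,k), where pi_N = P_(N+1) / P_N and
     P_N = (q^3;q^2)_(3N) (q^3;q^6)_N / ((q^2;q^2)_(3N) (q^6;q^6)_N),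
   so sum_k F(N,k) = P_N.  As N tends to infinity F(N,k) tends to u_k, dominated
   by c^(6k+1) |q|^(2k^2) with c = 2 / (1 - |q|), and Tannery's theorem applies. *)

(** * The finite identity and its rational certificate *)

Section Finite.
Variables (K : numFieldType) (q : K).
Hypothesis q_not_root : forall n, 1 - q ^+ n.+1 != 0.

Definition summand n : K :=
  q ^+ (2 * n ^ 2)
       * qpoch q (q ^+ 2) n ^+ 2 * qpoch q (q ^+ 2) (2 * n)
     / (qpoch (q ^+ 2) (q ^+ 2) (2 * n) * qpoch (q ^+ 6) (q ^+ 6) n ^+ 2)
     * qnum q (8 * n + 1).

(* The truncated subtractions are harmless: the factor j = N is 0, hence the
   product over j < k is 0 as soon as k > N. *)
Definition cutoff_factor N j : K :=
  (1 - q ^+ (6 * (N - j))) * (1 - q ^+ (6 * N + 6 * j + 3))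
  / ((1 - q ^+ (6 * N - 2 * j)) * (1 - q ^+ (6 * N + 2 * j + 3))).

Definition finite_summand N k : K := summand k * \prod_(j < k) cutoff_factor N j.

Definition partial_product N : K :=
  qpoch (q ^+ 3) (q ^+ 2) (3 * N) * qpoch (q ^+ 3) (q ^+ 6) N
  / (qpoch (q ^+ 2) (q ^+ 2) (3 * N) * qpoch (q ^+ 6) (q ^+ 6) N).

(* Below x, y and z stand for q^(2k), q^(6(N-k)) and q^(6N) = x^3 y; keeping y
   instead of z / x^3 avoids negative powers, so that q = 0 is not special. *)
Definition summand_ratio (x : K) : K :=
  (1 - q ^+ 9 * x ^+ 4) * (1 - q * x) ^+ 2 * (1 - q * x ^+ 2)
  * (1 - q ^+ 3 * x ^+ 2) * (q ^+ 2 * x ^+ 2)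
  / ((1 - q * x ^+ 4) * (1 - q ^+ 6 * x ^+ 3) ^+ 2 * (1 - q ^+ 2 * x ^+ 2)
     * (1 - q ^+ 4 * x ^+ 2)).

Definition product_ratio (z : K) : K :=
  (1 - z * q ^+ 3) ^+ 2 * (1 - z * q ^+ 5) * (1 - z * q ^+ 7)
  / ((1 - z * q ^+ 2) * (1 - z * q ^+ 4) * (1 - z * q ^+ 6) ^+ 2).

(** This is F(N+1,k) / F(N,k) for k <= N. Raising N by one moves the factors with exponents in steps
    of 6 by one place and those in steps of 2 by three places, so each of the four products over j
    telescopes. *)
Definition shift_ratio (x y : K) : K :=
  let z := x ^+ 3 * y in
  (1 - z * q ^+ 3 * x ^+ 3) * (1 - x ^+ 2 * y * q ^+ 6)
  * (1 - x ^+ 2 * y * q ^+ 4) * (1 - x ^+ 2 * y * q ^+ 2)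
  * (1 - z * q ^+ 5) * (1 - z * q ^+ 7)
  / ((1 - y * q ^+ 6) * (1 - z * q ^+ 4) * (1 - z * q ^+ 2)
     * (1 - z * q ^+ 3 * x) * (1 - z * q ^+ 5 * x) * (1 - z * q ^+ 7 * x)).

(* With G(N,k) = cert * F(N,k) one has G(N,k+1) = cert_next * F(N,k), where
   cert_next also makes sense at k = N. *)
Definition cert_next (x y : K) : K :=
  let z := x ^+ 3 * y in
  y * q ^+ 2 * x ^+ 2 * (z ^+ 2 * q ^+ 9 - 1) * (1 - q * x) ^+ 2
  * (1 - q * x ^+ 2) * (1 - q ^+ 3 * x ^+ 2) * (1 - z * q ^+ 3 * x ^+ 3)
  * (1 - z * q ^+ 5) * (1 - z * q ^+ 7)
  / ((1 - q * x ^+ 4) * (1 - z * q ^+ 3 * x) * (1 - z * q ^+ 5 * x)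
     * (1 - z * q ^+ 7 * x)
     * (1 - z * q ^+ 2) * (1 - z * q ^+ 4) * (1 - z * q ^+ 6) ^+ 2).

(** The factors (1 - x^3)^2 (1 - x^2) (q^2 - x^2) cancel the denominator of [summand_ratio] at k -
    1, and they vanish at k = 0. *)
Definition cert (x y : K) : K :=
  let z := x ^+ 3 * y in
  y * q ^+ 4 * (z ^+ 2 * q ^+ 9 - 1) * (1 - x ^+ 2 * y * q ^+ 2)
  * (1 - x ^+ 3) ^+ 2 * (1 - x ^+ 2) * (q ^+ 2 - x ^+ 2)
  * (1 - z * q ^+ 5) * (1 - z * q ^+ 7)
  / ((1 - q * x ^+ 4) * (1 - y * q ^+ 6) * (1 - z * q ^+ 3 * x)
     * (1 - z * q ^+ 5 * x)
     * (1 - z * q ^+ 2) * (1 - z * q ^+ 4) * (1 - z * q ^+ 6) ^+ 2).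

Lemma subr1_neq0 n (a : K) : a = q ^+ n -> (0 < n)%N -> 1 - a != 0.
Proof. by move=> ->; case: n. Qed.

Lemma qpochS (a p : K) n : qpoch a p n.+1 = qpoch a p n * (1 - a * p ^+ n).
Proof. by rewrite /qpoch big_ord_recr. Qed.

Lemma qpoch_neq0 (a p : K) i j n :
  a = q ^+ i.+1 -> p = q ^+ j -> qpoch a p n != 0.
Proof.
move=> -> ->; apply/prodf_neq0 => k _.
by rewrite -exprM -exprD addSn.
Qed.

(** After substitution every monomial is a single power of q: equalities of monomials reduce to
    equalities of exponents, and each denominator is 1 - q^n with n > 0. *)
Ltac merge_powers :=
  rewrite ?mul1r ?mulr1 ?exprMn -?exprM -?exprD -?exprS -?exprSr -?exprD.
Ltac powers := merge_powers; congr (_ ^+ _); nia.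
Ltac side := repeat (apply/andP; split);
  first [assumption | exact: (q_not_root 0)
        | merge_powers; apply: (subr1_neq0 erefl); lia].

Lemma summandS k : summand k.+1 = summand k * summand_ratio (q ^+ (2 * k)).
Proof.
rewrite /summand /summand_ratio /qnum.
have -> : (2 * k.+1 = (2 * k).+2)%N by lia.
rewrite !qpochS.
have n1 : qpoch (q ^+ 2) (q ^+ 2) (2 * k) != 0 by apply: (@qpoch_neq0 _ _ 1 2).
have n2 : qpoch (q ^+ 6) (q ^+ 6) k != 0 by apply: (@qpoch_neq0 _ _ 5 6).
set x := q ^+ (2 * k).
have -> : q ^+ (2 * k.+1 ^ 2) = q ^+ (2 * k ^ 2) * (q ^+ 2 * x ^+ 2) by rewrite /x; powers.
have -> : q ^+ (8 * k.+1 + 1) = q ^+ 9 * x ^+ 4 by rewrite /x; powers.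
have -> : q ^+ (8 * k + 1) = q * x ^+ 4 by rewrite /x; powers.
have -> : (q ^+ 2) ^+ k = x by rewrite /x; powers.
have -> : (q ^+ 6) ^+ k = x ^+ 3 by rewrite /x; powers.
have -> : (q ^+ 2) ^+ (2 * k) = x ^+ 2 by rewrite /x; powers.
have -> : (q ^+ 2) ^+ (2 * k).+1 = q ^+ 2 * x ^+ 2 by rewrite /x; powers.
by field; rewrite /x; side.
Qed.

Lemma partial_productS N :
  partial_product N.+1 = product_ratio (q ^+ (6 * N)) * partial_product N.
Proof.
rewrite /partial_product /product_ratio.
have -> : (3 * N.+1 = (3 * N).+3)%N by lia.
rewrite !qpochS.
have n1 : qpoch (q ^+ 2) (q ^+ 2) (3 * N) != 0 by apply: (@qpoch_neq0 _ _ 1 2).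
have n2 : qpoch (q ^+ 6) (q ^+ 6) N != 0 by apply: (@qpoch_neq0 _ _ 5 6).
set z := q ^+ (6 * N).
have -> : (q ^+ 6) ^+ N = z by rewrite /z; powers.
have -> : (q ^+ 2) ^+ (3 * N) = z by rewrite /z; powers.
have -> : (q ^+ 2) ^+ (3 * N).+1 = z * q ^+ 2 by rewrite /z; powers.
have -> : (q ^+ 2) ^+ (3 * N).+2 = z * q ^+ 4 by rewrite /z; powers.
by field; rewrite /z; side.
Qed.

Lemma finite_summandS N k :
  finite_summand N k.+1
  = finite_summand N k * summand_ratio (q ^+ (2 * k)) * cutoff_factor N k.
Proof. by rewrite /finite_summand big_ord_recr /= summandS; ring. Qed.

Lemma finite_summand_shift N k : (k <= N)%N ->
  finite_summand N.+1 k
  = shift_ratio (q ^+ (2 * k)) (q ^+ (6 * (N - k))) * finite_summand N k.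
Proof.
rewrite /finite_summand => kN; rewrite mulrCA; congr (_ * _).
elim: k kN => [_|k IHk kN].
  rewrite !big_ord0 /shift_ratio muln0 subn0 expr0.
  by field; side.
rewrite !big_ord_recr /= IHk ?(ltnW kN) //.
rewrite mulrAC [RHS]mulrA [RHS]mulrAC; congr (_ * _).
rewrite /shift_ratio /cutoff_factor.
(* With N = k + d + 1 all truncated differences are exact. Here [y] is the value q^(6d) belonging to
   k + 1, so the one belonging to k is q^6 y. *)
have [d ->] : exists d, N = (k + d.+1)%N by exists (N - k).-1; lia.
set x := q ^+ (2 * k); set y := q ^+ (6 * d).
have -> : q ^+ (2 * k.+1) = q ^+ 2 * x by rewrite /x; powers.
have -> : q ^+ (6 * (k + d.+1 - k)) = q ^+ 6 * y by rewrite /y; powers.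
have -> : q ^+ (6 * (k + d.+1 - k.+1)) = y by rewrite /y; powers.
have -> : q ^+ (6 * ((k + d.+1).+1 - k)) = q ^+ 12 * y by rewrite /y; powers.
have -> : q ^+ (6 * (k + d.+1) + 6 * k + 3) = x ^+ 6 * y * q ^+ 9 by rewrite /y /x; powers.
have -> : q ^+ (6 * (k + d.+1).+1 + 6 * k + 3) = x ^+ 6 * y * q ^+ 15 by rewrite /y /x; powers.
have -> : q ^+ (6 * (k + d.+1) + 2 * k + 3) = x ^+ 4 * y * q ^+ 9 by rewrite /y /x; powers.
have -> : q ^+ (6 * (k + d.+1).+1 + 2 * k + 3) = x ^+ 4 * y * q ^+ 15 by rewrite /y /x; powers.
have -> : q ^+ (6 * (k + d.+1) - 2 * k) = x ^+ 2 * y * q ^+ 6 by rewrite /y /x; powers.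
have -> : q ^+ (6 * (k + d.+1).+1 - 2 * k) = x ^+ 2 * y * q ^+ 12 by rewrite /y /x; powers.
by field; rewrite /x /y; side.
Qed.

(** The Wilf-Zeilberger equation divided by F(N,k), with N = k + d. Clearing denominators leaves a
    polynomial identity in q, x and y; taking x and y to be powers of q ensures that the
    denominators are nonzero. *)
Lemma certE k d (x := q ^+ (2 * k)) (y := q ^+ (6 * d)) :
  shift_ratio x y - product_ratio (x ^+ 3 * y) = cert_next x y - cert x y.
Proof.
rewrite /shift_ratio /product_ratio /cert_next /cert.
by field; rewrite /x /y; side.
Qed.

(** Lower boundary of the telescoping: G(N,0) = 0, as x = 1 when k = 0. *)
Lemma cert1 y : cert 1 y = 0.
Proof. by rewrite /cert !expr1n subrr !(mulr0, mul0r). Qed.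

Lemma cert_finite_summandS N k : (k < N)%N ->
  cert (q ^+ (2 * k.+1)) (q ^+ (6 * (N - k.+1))) * finite_summand N k.+1
  = cert_next (q ^+ (2 * k)) (q ^+ (6 * (N - k))) * finite_summand N k.
Proof.
move=> kN; rewrite finite_summandS -[_ * _ * cutoff_factor _ _]mulrA.
rewrite mulrCA [LHS]mulrC; congr (_ * _).
rewrite /summand_ratio /cutoff_factor /cert /cert_next.
have [d ->] : exists d, N = (k + d.+1)%N by exists (N - k).-1; lia.
set x := q ^+ (2 * k); set y := q ^+ (6 * d).
have -> : q ^+ (2 * k.+1) = q ^+ 2 * x by rewrite /x; powers.
have -> : q ^+ (6 * (k + d.+1 - k)) = q ^+ 6 * y by rewrite /y; powers.
have -> : q ^+ (6 * (k + d.+1 - k.+1)) = y by rewrite /y; powers.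
have -> : q ^+ (6 * (k + d.+1) + 6 * k + 3) = x ^+ 6 * y * q ^+ 9 by rewrite /y /x; powers.
have -> : q ^+ (6 * (k + d.+1) + 2 * k + 3) = x ^+ 4 * y * q ^+ 9 by rewrite /y /x; powers.
have -> : q ^+ (6 * (k + d.+1) - 2 * k) = x ^+ 2 * y * q ^+ 6 by rewrite /y /x; powers.
by field; rewrite /x /y; side.
Qed.

(** Upper boundary: as F(N,N+1) = 0, the Wilf-Zeilberger equation at k = N + 1 reduces to F(N+1,N+1)
    = -G(N,N+1), and G(N,N+1) is expressed through [cert_next] at k = N, where y = 1. *)
Lemma finite_summand_diag N :
  finite_summand N.+1 N.+1 = - cert_next (q ^+ (2 * N)) 1 * finite_summand N N.
Proof.
rewrite finite_summandS finite_summand_shift // subnn muln0 expr0.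
move: (finite_summand N N) => F.
rewrite /shift_ratio /summand_ratio /cutoff_factor /cert_next.
set x := q ^+ (2 * N).
have -> : q ^+ (6 * (N.+1 - N)) = q ^+ 6 by powers.
have -> : q ^+ (6 * N.+1 + 6 * N + 3) = x ^+ 6 * q ^+ 9 by rewrite /x; powers.
have -> : q ^+ (6 * N.+1 + 2 * N + 3) = x ^+ 4 * q ^+ 9 by rewrite /x; powers.
have -> : q ^+ (6 * N.+1 - 2 * N) = x ^+ 2 * q ^+ 6 by rewrite /x; powers.
by field; rewrite /x; side.
Qed.

(** The sum collapses to G(N,m+1) - G(N,0), and the second term is zero. *)
Lemma telescope_cert N m : (m <= N)%N ->
  \sum_(k < m.+1) (finite_summand N.+1 k - product_ratio (q ^+ (6 * N)) * finite_summand N k)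
  = cert_next (q ^+ (2 * m)) (q ^+ (6 * (N - m))) * finite_summand N m.
Proof.
have step k : (k <= N)%N ->
    finite_summand N.+1 k - product_ratio (q ^+ (6 * N)) * finite_summand N k
    = (cert_next (q ^+ (2 * k)) (q ^+ (6 * (N - k)))
       - cert (q ^+ (2 * k)) (q ^+ (6 * (N - k)))) * finite_summand N k.
  move=> kN; rewrite finite_summand_shift // -mulrBl -certE; congr ((_ - product_ratio _) * _).
  by powers.
elim: m => [_|m IHm mN].
  rewrite big_ord_recr big_ord0 /= step //.
  by rewrite add0r muln0 expr0 cert1 subr0.
rewrite big_ord_recr /= (IHm (ltnW mN)) (step _ mN).
by rewrite [in LHS]mulrBl (cert_finite_summandS mN) addrC subrK.
Qed.

Lemma finite_sum N : \sum_(k < N.+1) finite_summand N k = partial_product N.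
Proof.
elim: N => [|N IHN].
  rewrite big_ord_recr big_ord0 /finite_summand /summand /partial_product /qpoch /qnum /=.
  rewrite !(muln0, big_ord0, expr0, add0n, expr1).
  by field; side.
rewrite big_ord_recr /= finite_summand_diag partial_productS -IHN mulr_sumr.
(* The extra term k = N + 1 cancels the telescoped sum taken up to m = N. *)
apply/eqP; rewrite mulNr subr_eq addrC -subr_eq -sumrB telescope_cert //.
by rewrite subnn muln0 expr0.
Qed.
End Finite.

(** * Tannery's theorem for sums with a moving upper limit *)

(** For fixed m, l minus the m-th partial sum of u is the limit of the tails from m on, which [T m]
    bounds uniformly in n. Convergence of the series is thus a conclusion. *)
Lemma tannery (K : numFieldType) (f : nat -> nat -> K) (u T : nat -> K) (l : K) :
    (forall k, f n k @[n --> \oo] --> u k) ->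
    (\sum_(k < n.+1) f n k) @[n --> \oo] --> l ->
    (forall m, 0 < T m) ->
    (forall n m, (m <= n.+1)%N -> `|\sum_(m <= k < n.+1) f n k| <= T m) ->
    T @ \oo --> (0 : K) ->
  series u @ \oo --> l.
Proof.
move=> fu fl T0 fT Tl.
have psum m : (\sum_(0 <= k < m) f n k) @[n --> \oo] --> series u m.
  rewrite /series /=; elim: m => [|m IHm].
    rewrite big_geq //; under eq_fun do rewrite big_geq //.
    exact: cvg_cst.
  rewrite big_nat_recr //=; under eq_fun do rewrite big_nat_recr //=.
  exact: cvgD IHm (fu m).
apply/cvgrPdist_lt => e e0.
have e20 : 0 < e / 2 by rewrite divr_gt0.
move/cvgrPdist_lt : Tl => /(_ _ e20) [m0 _ hm0].
exists m0 => // m /= m0m.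
have Tm : T m < e / 2.
  by have := hm0 m m0m; rewrite /= sub0r normrN gtr0_norm.
have : (\sum_(k < n.+1) f n k - \sum_(0 <= k < m) f n k) @[n --> \oo] --> l - series u m.
  exact: cvgB fl (psum m).
move/cvgrPdist_lt => /(_ _ e20) [n0 _ hn0].
(* The index must be large for the limit and at least m for the tail bound. *)
have := hn0 (maxn n0 m) (leq_maxl _ _) => /=.
set n := maxn n0 m.
have mn : (m <= n.+1)%N by rewrite (leq_trans (leq_maxr n0 m)).
rewrite -(big_mkord xpredT (f n)) (big_cat_nat (leq0n m) mn) /=.
rewrite [_ + \sum_(m <= _ < _) _]addrC addrK => h.
rewrite -(subrK (\sum_(m <= k < n.+1) f n k) (l - series u m)).
rewrite (le_lt_trans (ler_normD _ _)) // (splitr e).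
by apply: ltrD => //; rewrite (le_lt_trans (fT _ _ mn)).
Qed.

(** * Convergence and nonvanishing of infinite q-products *)

Lemma geometric_neq1 (K : numFieldType) (a p : K) n :
  `|a| < 1 -> `|p| < 1 -> 1 - a * p ^+ n != 0.
Proof.
move=> a1 p1; rewrite subr_eq0; apply/eqP => apn.
have : `|a * p ^+ n| < 1.
  by rewrite normrM normrX (le_lt_trans _ a1) // ler_piMr // exprn_ile1 // ltW.
by rewrite -apn normr1 ltxx.
Qed.

(** The denominator has norm at least 1 - |a|. The bound makes the product of the reciprocals 1 / (1
    - a p^n) converge. *)
Lemma norm_div_1B_le (K : numFieldType) (a p : K) n : `|a| < 1 -> `|p| < 1 ->
  `|a * p ^+ n / (1 - a * p ^+ n)| <= `|a| / (1 - `|a|) * `|p| ^+ n.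
Proof.
move=> a1 p1; rewrite [X in _ <= X]mulrAC normf_div normrM normrX.
apply: ler_wpM2l; first by rewrite mulr_ge0 ?exprn_ge0.
rewrite lef_pV2 ?posrE ?normr_gt0 ?subr_gt0 ?geometric_neq1 //.
apply: le_trans (lerB_dist _ _); rewrite normr1 lerD2l lerN2.
by rewrite normrM normrX ler_piMr // exprn_ile1 // ltW.
Qed.

Section Complex.
Variable R : realType.
(* [R[i]] carries no topology of its own; the cast gives it that of a [numFieldType],
   the one in which [qpoch_inf] takes its limit. *)
Local Notation C := (R[i] : numFieldType).
Local Open Scope complex_scope.
Implicit Types (c t : R).

Lemma norm_complexR t : `|t%:C| = `|t|%:C :> C.
Proof. by rewrite normc_def /= expr0n addr0 sqrtr_sqr. Qed.

(** Norms on [R[i]] take values in [R[i]]; a real representative lets estimates be carried out in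
    [R]. *)
Lemma norm_of_complex (z : C) : exists2 t : R, 0 <= t & `|z| = t%:C.
Proof. by rewrite normc_def; eexists; last reflexivity; exact: sqrtr_ge0. Qed.

Lemma pos_complexR (e : C) : 0 < e -> exists2 t : R, 0 < t & e = t%:C.
Proof.
move=> e0; have /complex_realP [t et] := gtr0_real e0.
by exists t => //; rewrite -ltcR -et.
Qed.

Lemma cvg_complexR (r : nat -> R) (l : R) :
  r @ \oo --> l -> ((r n)%:C : C) @[n --> \oo] --> (l%:C : C).
Proof.
move=> /cvgrPdist_lt rl; apply/cvgrPdist_lt => e /pos_complexR[t t0 ->].
have [N _ hN] := rl _ t0; exists N => // n /hN /=.
by rewrite -rmorphB norm_complexR ltcR.
Qed.

Lemma cvg_exprC (z : C) : `|z| < 1 -> z ^+ n @[n --> \oo] --> (0 : C).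
Proof.
have [t t0 zt] := norm_of_complex z.
rewrite zt -[1]/(1%:C) ltcR => t1.
apply: norm_cvg0; under eq_fun do rewrite normrX zt -rmorphXn.
apply: cvg_complexR; apply: cvg_expr.
by rewrite ger0_norm.
Qed.

Lemma cvg_geometric_increments (w : nat -> R) c t : 0 <= t < 1 ->
  (forall n, `|w n.+1 - w n| <= c * t ^+ n) -> cvgn w.
Proof.
move=> /andP[t0 t1] wct.
have : cvgn (series (telescope w)).
  apply: normed_cvg; apply: (@series_le_cvg _ _ (geometric c t)) => //=.
    by move=> n; rewrite (le_trans _ (wct n)).
  by apply: is_cvg_geometric_series; rewrite ger0_norm.
move=> /cvg_ex[l hl]; apply/cvg_ex; exists (w 0 + l).
have ew : w = (fun n => w 0 + series (telescope w) n).
  by apply/funext => n; rewrite [LHS]eq_sum_telescope.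
by rewrite {1}ew; exact: cvgD (cvg_cst _) hl.
Qed.

Lemma cvg_geometric_incrementsC (w : nat -> C) c t : 0 <= t < 1 ->
  (forall n, `|w n.+1 - w n| <= (c * t ^+ n)%:C) -> exists l : C, w @ \oo --> l.
Proof.
move=> t01 wct.
have /cvg_ex[a /cvg_complexR ha] : cvgn (fun n => complex.Re (w n)).
  apply: (@cvg_geometric_increments _ c t) => // n.
  rewrite -lecR; apply: le_trans (wct n).
  by rewrite -(raddfB (@complex.Re R)); exact: normc_ge_Re.
have /cvg_ex[b /cvg_complexR hb] : cvgn (fun n => complex.Im (w n)).
  apply: (@cvg_geometric_increments _ c t) => // n.
  rewrite -lecR; apply: le_trans (wct n).
  (* The imaginary part is minus the real part after multiplication by i, a number of norm 1. *)
  rewrite -(raddfB (@complex.Im R)) -normrN -ReiNIm; apply: (le_trans (normc_ge_Re _)).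
  by rewrite normrM [X in _ * X]normc_def /= expr0n expr1n add0r sqrtr1 mulr1.
exists (a%:C + 'i * b%:C).
have -> : w = (fun n => (complex.Re (w n))%:C + 'i * (complex.Im (w n))%:C).
  by apply/funext => n; exact: complexE.
exact: (@cvgD C C _ _ _ _ _ _ _ ha (@cvgM C _ _ _ _ _ _ _ (cvg_cst _) hb)).
Qed.

Lemma prod_1D_geometric_le c t n : 0 <= c -> 0 <= t < 1 ->
  \prod_(j < n) (1 + c * t ^+ j) <= expR (c / (1 - t)).
Proof.
move=> c0 /andP[t0 t1]; have t1' : 0 < 1 - t by rewrite subr_gt0.
(* The partial geometric sum in the exponent makes the induction work, each step being 1 + x <= exp
   x. *)
suff : \prod_(j < n) (1 + c * t ^+ j) <= expR (c * (1 - t ^+ n) / (1 - t)).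
  move/le_trans; apply; rewrite ler_expR ler_pM2r ?invr_gt0 //.
  by rewrite ler_piMr // gerBl exprn_ge0.
elim: n => [|n IHn]; first by rewrite big_ord0 expr0 subrr mulr0 mul0r expR0.
rewrite big_ord_recr /=.
have -> : c * (1 - t ^+ n.+1) / (1 - t) = c * (1 - t ^+ n) / (1 - t) + c * t ^+ n.
  by rewrite exprS; field; rewrite gt_eqF.
rewrite expRD; apply: ler_pM => //; last exact: expR_ge1Dx.
  by apply: prodr_ge0 => j _; rewrite addr_ge0 // mulr_ge0 // exprn_ge0.
by rewrite addr_ge0 // mulr_ge0 // exprn_ge0.
Qed.

Lemma cvg_prod_1D (a : nat -> C) c t : 0 <= c -> 0 <= t < 1 ->
  (forall n, `|a n| <= (c * t ^+ n)%:C) ->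
  exists l : C, (\prod_(j < n) (1 + a j)) @[n --> \oo] --> l.
Proof.
move=> c0 t01 act.
(* An increment is [a n] times the n-th partial product, whose norm is at most
   [expR (c / (1 - t))]. *)
apply: (@cvg_geometric_incrementsC _ (expR (c / (1 - t)) * c) t) => // n.
rewrite big_ord_recr /= mulrDr mulr1 addrAC subrr add0r normrM -mulrA rmorphM.
apply: ler_pM => //; rewrite normr_prod.
apply: (@le_trans _ _ (\prod_(j < n) (1 + c * t ^+ j))%:C); last first.
  by rewrite lecR prod_1D_geometric_le.
rewrite rmorph_prod; apply: ler_prod => j _; rewrite normr_ge0 /=.
by rewrite (le_trans (ler_normD _ _)) // normr1 rmorphD lerD2l.
Qed.

Lemma cvg_qpoch (a p : C) : `|p| < 1 -> exists l : C, qpoch a p @ \oo --> l.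
Proof.
have [t t0 pt] := norm_of_complex p; have [c c0 ac] := norm_of_complex a.
rewrite pt -[1]/(1%:C) ltcR => t1.
apply: (@cvg_prod_1D (fun j => - (a * p ^+ j)) c t) => //.
  by rewrite t0.
by move=> n; rewrite normrN normrM normrX pt ac rmorphM rmorphXn.
Qed.

Lemma cvg_qpoch_inf (a p : C) : `|p| < 1 -> qpoch a p @ \oo --> qpoch_inf a p.
Proof. by move=> /(cvg_qpoch a)[l hl]; rewrite /qpoch_inf (cvg_lim _ hl). Qed.

(* The reciprocals 1 + b j of the factors also have a convergent product. *)
Lemma qpoch_inf_neq0 (a p : C) : `|a| < 1 -> `|p| < 1 -> qpoch_inf a p != 0.
Proof.
move=> a1 p1; have cv := @cvg_qpoch_inf a p p1.
pose b j : C := a * p ^+ j / (1 - a * p ^+ j).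
have [l hl] : exists l : C, (\prod_(j < n) (1 + b j)) @[n --> \oo] --> l.
  have [t t0 pt] := norm_of_complex p; have [c c0 ac] := norm_of_complex a.
  move: (a1) (p1); rewrite pt ac -[1]/(1%:C) !ltcR => c1 t1.
  apply: (@cvg_prod_1D b (c / (1 - c)) t).
  - by rewrite divr_ge0 // subr_ge0 ltW.
  - by rewrite t0.
  move=> n; have -> : (c / (1 - c) * t ^+ n)%:C = `|a| / (1 - `|a|) * `|p| ^+ n.
    by rewrite ac pt !rmorphM fmorphV rmorphB rmorph1 rmorphXn.
  exact: norm_div_1B_le.
have inv_b n : qpoch a p n * \prod_(j < n) (1 + b j) = 1.
  rewrite /qpoch -big_split big1 //= => j _; rewrite /b.
  by field; apply: geometric_neq1.
have : qpoch a p n * \prod_(j < n) (1 + b j) @[n --> \oo] --> qpoch_inf a p * l.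
  exact: cvgM cv hl.
under eq_fun do rewrite inv_b.
move=> /(cvg_lim (@norm_hausdorff _ _)); rewrite lim_cst; last exact: norm_hausdorff.
by apply: contra_eqN => /eqP ->; rewrite mul0r oner_eq0.
Qed.

End Complex.

(** * Termwise limits as N tends to infinity *)

(** The slack [i] accommodates exponents with truncated subtraction, such as 6 (N - j). *)
Lemma cvg_infty_sub (e : nat -> nat) i :
  (forall n, (n <= e n + i)%N) -> e @ \oo --> \oo.
Proof.
move=> ne A [m _ mA]; exists (m + i)%N => // n /= min; apply: mA => /=.
by have := ne n; lia.
Qed.

Lemma sum_half_le (K : numFieldType) m n : (m <= n)%N ->
  \sum_(m <= k < n) (2^-1 : K) ^+ k <= 2 * 2^-1 ^+ m.
Proof.
move=> mn.
(* Adding the missing tail turns the bound into an equality, which induction can prove. *)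
suff <- : \sum_(m <= k < n) (2^-1 : K) ^+ k + 2 * 2^-1 ^+ n = 2 * 2^-1 ^+ m.
  by rewrite lerDl mulr_ge0 // exprn_ge0 // invr_ge0.
rewrite -(subnKC mn); elim: (n - m)%N => [|d IHd].
  by rewrite addn0 big_geq // add0r.
rewrite -IHd addnS big_nat_recr ?leq_addr //= exprS.
by field.
Qed.

Section Limits.
Variables (K : numFieldType) (q : K).
Hypothesis cvg_expr_q : q ^+ n @[n --> \oo] --> (0 : K).

Lemma cvg_expr_infty (e : nat -> nat) i : (forall n, (n <= e n + i)%N) ->
  q ^+ e n @[n --> \oo] --> (0 : K).
Proof.
by move=> ne; exact: (cvg_comp _ _ (cvg_infty_sub ne) cvg_expr_q).
Qed.

Lemma cvg_1B_expr (e : nat -> nat) i : (forall n, (n <= e n + i)%N) ->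
  1 - q ^+ e n @[n --> \oo] --> (1 : K).
Proof.
move=> ne; rewrite -[X in _ --> X]subr0.
by apply: cvgB; [exact: cvg_cst | exact: (cvg_expr_infty ne)].
Qed.

Lemma cvg_cutoff_factor j : cutoff_factor q N j @[N --> \oo] --> (1 : K).
Proof.
rewrite [X in _ --> X](_ : 1 = (1 * 1) / (1 * 1)); last by rewrite mulr1 divr1.
apply: cvgM.
  by apply: cvgM; [apply: (@cvg_1B_expr _ j) | apply: (@cvg_1B_expr _ 0)] => n; lia.
apply: cvgV; first by rewrite mulr1 oner_eq0.
by apply: cvgM; [apply: (@cvg_1B_expr _ (2 * j)) | apply: (@cvg_1B_expr _ 0)] => n; lia.
Qed.

Lemma cvg_finite_summand k :
  finite_summand q N k @[N --> \oo] --> summand q k.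
Proof.
rewrite -[X in _ --> X]mulr1; apply: cvgM; first exact: cvg_cst.
elim: k => [|k IHk].
  by under eq_fun do rewrite big_ord0; exact: cvg_cst.
rewrite -[X in _ --> X]mulr1; under eq_fun do rewrite big_ord_recr /=.
exact: cvgM IHk (cvg_cutoff_factor k).
Qed.

End Limits.

(** * Domination uniform in N *)

Section Bounds.
Variables (K : numFieldType) (q : K).
Hypothesis q1 : `|q| < 1.
Hypothesis cvg_expr_q : q ^+ n @[n --> \oo] --> (0 : K).

Let v := (1 - `|q|)^-1.

Let v_gt0 : 0 < v. Proof. by rewrite invr_gt0 subr_gt0. Qed.

Lemma expr_neq1 n : 1 - q ^+ n.+1 != 0.
Proof. by rewrite exprS geometric_neq1. Qed.

Lemma norm_1B_expr_le n : `|1 - q ^+ n| <= 2.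
Proof.
rewrite (le_trans (ler_normB _ _)) // normr1 normrX -[2]/(1 + 1) lerD2l.
by rewrite exprn_ile1 // ltW.
Qed.

Lemma norm_1B_exprV_le n : (0 < n)%N -> `|1 - q ^+ n|^-1 <= v.
Proof.
case: n => // n _; rewrite lef_pV2 ?posrE ?normr_gt0 ?subr_gt0 ?expr_neq1 //.
apply: le_trans (lerB_dist _ _); rewrite normr1 lerD2l lerN2 normrX exprS.
by rewrite ler_piMr // exprn_ile1 // ltW.
Qed.

Lemma norm_qpoch_le i j n : `|qpoch (q ^+ i) (q ^+ j) n| <= 2 ^+ n.
Proof.
rewrite normr_prod -[n in X in _ <= X]card_ord -prodr_const.
by apply: ler_prod => k _; rewrite normr_ge0 -exprM -exprD norm_1B_expr_le.
Qed.

Lemma norm_qpochV_le i j n : (0 < i)%N -> `|qpoch (q ^+ i) (q ^+ j) n|^-1 <= v ^+ n.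
Proof.
move=> i0; rewrite normr_prod -prodfV -[n in X in _ <= X]card_ord -prodr_const.
apply: ler_prod => k _; rewrite invr_ge0 normr_ge0 -exprM -exprD norm_1B_exprV_le //.
by rewrite addn_gt0 i0.
Qed.

Lemma norm_cutoff_factor_le N j : (j < N)%N ->
  `|cutoff_factor q N j| <= 2 * 2 * (v * v).
Proof.
move=> jN; rewrite /cutoff_factor normf_div !normrM invfM.
by rewrite !ler_pM ?mulr_ge0 ?invr_ge0 ?normr_ge0 ?norm_1B_expr_le ?norm_1B_exprV_le //; lia.
Qed.

Lemma norm_summand_le k :
  `|summand q k| <= `|q| ^+ (2 * k ^ 2) * (2 ^+ k) ^+ 2 * 2 ^+ (2 * k)
                    * (v ^+ (2 * k) * (v ^+ k) ^+ 2) * (2 * v).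
Proof.
have qE : q = q ^+ 1 by rewrite expr1.
rewrite /summand /qnum !normrM !normfV !normrM !normrX.
rewrite -!expr2 invfM -exprVn.
rewrite ler_pM ?mulr_ge0 ?exprn_ge0 ?invr_ge0 //; last first.
  rewrite ler_pM ?invr_ge0 ?norm_1B_expr_le //.
  by rewrite {1}qE norm_1B_exprV_le.
rewrite ler_pM ?mulr_ge0 ?exprn_ge0 ?invr_ge0 //; last first.
  rewrite ler_pM ?exprn_ge0 ?invr_ge0 ?norm_qpochV_le //.
  by rewrite lerXn2r ?nnegrE ?exprn_ge0 ?(ltW v_gt0) ?invr_ge0 ?norm_qpochV_le.
have poch n : `|qpoch q (q ^+ 2) n| <= 2 ^+ n by rewrite {1}qE norm_qpoch_le.
rewrite ler_pM ?mulr_ge0 ?exprn_ge0 ?poch //.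
rewrite ler_wpM2l ?exprn_ge0 //.
by rewrite lerXn2r ?nnegrE ?exprn_ge0 ?poch.
Qed.

(** Numerator factors 1 - q^n contribute at most 2 and inverse ones at most [v]. The q-products in
    [summand] hold 4k of each, the cutoff 2k of each, and the q-number one of each. *)
Lemma norm_finite_summand_le N k : (k <= N)%N ->
  `|finite_summand q N k|
  <= 2 * v * (((2 * v) ^+ 6) ^+ k * `|q| ^+ (2 * k ^ 2)).
Proof.
move=> kN.
have -> : 2 * v * (((2 * v) ^+ 6) ^+ k * `|q| ^+ (2 * k ^ 2)) =
    `|q| ^+ (2 * k ^ 2) * (2 ^+ k) ^+ 2 * 2 ^+ (2 * k)
    * (v ^+ (2 * k) * (v ^+ k) ^+ 2) * (2 * v) * (2 * 2 * (v * v)) ^+ k.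
  rewrite (exprAC _ 6 k) !(exprMn k) !(mulnC 2 k) !(exprM _ k 2).
  by ring.
rewrite normrM ler_pM ?norm_summand_le //.
rewrite normr_prod -[k in X in _ <= X]card_ord -prodr_const.
apply: ler_prod => j _; rewrite normr_ge0 norm_cutoff_factor_le //.
by rewrite (leq_trans (ltn_ord j)).
Qed.

(** The quantity is (b |q|^(2k))^k, which is at most 1 once b |q|^(2k) < 1. The finitely many k <= m
    are covered by (1 + b)^m, whose base is at least 1 so that its powers increase. *)
Lemma quadratic_decay (b : K) : 0 <= b ->
  exists2 A : K, 0 < A & forall k, b ^+ k * `|q| ^+ (2 * k ^ 2) <= A.
Proof.
move=> b0.
have : b * q ^+ n @[n --> \oo] --> b * 0 by apply: cvgM => //; exact: cvg_cst.
rewrite mulr0 => /cvgrPdist_lt /(_ _ ltr01) [m _ hm].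
have b1 : 1 <= 1 + b by rewrite lerDl.
exists ((1 + b) ^+ m); first by rewrite exprn_gt0 // (lt_le_trans ltr01).
move=> k; have q01 n : `|q| ^+ n <= 1 by rewrite exprn_ile1 // ltW.
have [km|mk] := leqP k m.
  apply: (@le_trans _ _ ((1 + b) ^+ k)); last by rewrite ler_weXn2l.
  rewrite -[leRHS]mulr1 ler_pM ?exprn_ge0 // lerXn2r ?nnegrE //.
    by rewrite (le_trans ler01).
  by rewrite lerDr.
apply: (@le_trans _ _ 1); last by rewrite exprn_ege1.
rewrite -mulnn mulnA exprM -exprMn exprn_ile1 //.
  by rewrite mulr_ge0 // exprn_ge0.
have := hm (2 * k)%N; rewrite /= sub0r normrN normrM normrX (ger0_norm b0) => h.
by apply/ltW/h; lia.
Qed.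

Lemma sum_finite_summand_tail : exists2 A : K, 0 < A & forall n m, (m <= n.+1)%N ->
  `|\sum_(m <= k < n.+1) finite_summand q n k| <= A * 2^-1 ^+ m.
Proof.
have c0 : 0 < 2 * v by rewrite mulr_gt0.
(* The extra factor 2 in the base leaves a weight 2^(-k) on the k-th term, hence a geometric
   tail. *)
have [|A A0 hA] := @quadratic_decay (2 * (2 * v) ^+ 6).
  by rewrite mulr_ge0 // exprn_ge0 // ltW.
exists (2 * v * A * 2) => [|n m mn]; first by rewrite !mulr_gt0.
rewrite (le_trans (ler_norm_sum _ _ _)) //.
apply: (@le_trans _ _ (\sum_(m <= k < n.+1) 2 * v * A * 2^-1 ^+ k)); last first.
  rewrite -mulr_sumr -[leRHS]mulrA ler_wpM2l ?sum_half_le //.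
  by rewrite ltW // mulr_gt0.
rewrite big_nat [leRHS]big_nat; apply: ler_sum => k /andP[_ kn].
rewrite (le_trans (@norm_finite_summand_le n k kn)) // -[leRHS]mulrA.
rewrite ler_wpM2l ?(ltW c0) //.
rewrite exprVn ler_pdivlMr ?exprn_gt0 // mulrAC -exprMn (mulrC _ 2).
exact: hA.
Qed.

End Bounds.

(** * Passage to the limit on both sides *)

Lemma cvg_partial_product (K : numFieldType) (q a b c d : K) :
    qpoch (q ^+ 3) (q ^+ 2) @ \oo --> a -> qpoch (q ^+ 3) (q ^+ 6) @ \oo --> b ->
    qpoch (q ^+ 2) (q ^+ 2) @ \oo --> c -> qpoch (q ^+ 6) (q ^+ 6) @ \oo --> d ->
    c != 0 -> d != 0 ->
  partial_product q @ \oo --> a * b / (c * d).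
Proof.
have triple : (fun n => (3 * n)%N) @ \oo --> \oo.
  by apply: (@cvg_infty_sub _ 0) => n; lia.
move=> ha hb hc hd c0 d0; apply: cvgM.
  by apply: cvgM hb; exact: (cvg_comp _ _ triple ha).
apply: cvgV; first by rewrite mulf_neq0.
by apply: cvgM hd; exact: (cvg_comp _ _ triple hc).
Qed.

Theorem theorem2 (R : realType) (q : R[i]) (hq : `|q| < 1) :
  series (fun n : nat =>
    (q ^+ (2 * n ^ 2)
       * qpoch q (q ^+ 2) n ^+ 2 * qpoch q (q ^+ 2) (2 * n)
     / (qpoch (q ^+ 2) (q ^+ 2) (2 * n) * qpoch (q ^+ 6) (q ^+ 6) n ^+ 2)
     * qnum q (8 * n + 1) : R[i]^o)) @ \oo -->
  (qpoch_inf (q ^+ 3) (q ^+ 2) * qpoch_inf (q ^+ 3) (q ^+ 6)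
   / (qpoch_inf (q ^+ 2) (q ^+ 2) * qpoch_inf (q ^+ 6) (q ^+ 6)) : R[i]^o).
Proof.
have cq := cvg_exprC hq.
have qX n : `|q ^+ n.+1| < 1 by rewrite normrX exprn_ilt1.
have [A A0 tail] := sum_finite_summand_tail hq cq.
apply: (@tannery R[i] (finite_summand q) (summand q) (fun m => A * 2^-1 ^+ m)).
- exact: (cvg_finite_summand cq).
- under eq_fun do rewrite (finite_sum (expr_neq1 hq)).
  apply: (@cvg_partial_product R[i]).
  + exact: (cvg_qpoch_inf (qX 1)).
  + exact: (cvg_qpoch_inf (qX 5)).
  + exact: (cvg_qpoch_inf (qX 1)).
  + exact: (cvg_qpoch_inf (qX 5)).
  + exact: (qpoch_inf_neq0 (qX 1) (qX 1)).
  + exact: (qpoch_inf_neq0 (qX 5) (qX 5)).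
- by move=> m; rewrite mulr_gt0 // exprn_gt0 // invr_gt0.
- exact: tail.
rewrite -[X in _ --> X](mulr0 A); apply: cvgM; first exact: cvg_cst.
by apply: cvg_exprC; rewrite normfV normr_nat invf_lt1 ?ltr1n.
Qed.
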